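(* Let $Y = X\beta^* + \varepsilon$ with $Y,\varepsilon\in\mathbb{R}^n$, $X\in\mathbb{R}^{n\times p}$, $\beta^*\in\mathbb{R}^p$, and let $c\in(0,2)$. Let $\hat\beta$ be any TREX estimator with constant $c$, and set $\hat u := \|X^\top(Y-X\hat\beta)\|_\infty$. Assume that $$\|X^\top X\beta^*\|_\infty \ge \Big(1+\frac{2}{c}\Big)\|X^\top\varepsilon\|_\infty.$$ If $\hat u\le\|X^\top Y\|_\infty$, then $$\frac{\|X\hat\beta-X\beta^*\|_2^2}{n}\le\frac{\big(2\|X^\top\varepsilon\|_\infty+\max\{\hat u,\ 2\|X^\top\varepsilon\|_\infty/c\}\big)\,\|\beta^*\|_1}{n}.$$
   Context: The design matrix $X$ is fixed and each of its columns has Euclidean norm $\sqrt n$. No distributional assumption is made on the noise vector $\varepsilon$ (the statement is deterministic), and $p>n$ is allowed. TREX: for a constant $c\in(0,2)$, a TREX estimator is any minimizer $$\hat\beta\in\operatorname{argmin}_{\beta\in\mathbb{R}^p}\Big\{\frac{\|Y-X\beta\|_2^2}{c\,\|X^\top(Y-X\beta)\|_\infty}+\|\beta\|_1\Big\}.$$ Norms: $\|v\|_1=\sum_i|v_i|$, $\|v\|_2=(\sum_i v_i^2)^{1/2}$, $\|v\|_\infty=\max_i|v_i|$. Quotients presuppose non-zero denominators. *)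

(* Defs.v *)
From HB Require Import structures.
From mathcomp Require Import all_boot all_order all_algebra.
From mathcomp Require Import classical_sets reals normedtype.
Set Implicit Arguments.
Unset Strict Implicit.
Unset Printing Implicit Defensive.
Import Order.TTheory GRing.Theory Num.Theory.
Local Open Scope classical_set_scope.
Local Open Scope ring_scope.

Definition norm1 (R : realType) (m : nat) (v : 'cV[R]_m) : R :=
  \sum_(i < m) `|v i 0|.

Definition norm2 (R : realType) (m : nat) (v : 'cV[R]_m) : R :=
  Num.sqrt (\sum_(i < m) v i 0 ^+ 2).

(* [mx_norm] is the largest absolute value of an entry (see [mx_normrE]). *)
Definition normoo (R : realType) (m : nat) (v : 'cV[R]_m) : R := mx_norm v.

Definition argmin (R : realType) (T : Type) (D : set T) (f : T -> R) : set T :=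
  [set x | D x /\ forall y, D y -> f x <= f y].

(* Division by 0 is total here, with value 0, so the points at which the
   denominator of [trex_obj] vanishes have to be left out explicitly. *)
Definition trex_dom (R : realType) (n p : nat) (X : 'M[R]_(n, p))
    (Y : 'cV[R]_n) : set 'cV[R]_p :=
  [set b | normoo (X^T *m (Y - X *m b)) != 0].

Definition trex_obj (R : realType) (n p : nat) (c : R) (X : 'M[R]_(n, p))
    (Y : 'cV[R]_n) (b : 'cV[R]_p) : R :=
  norm2 (Y - X *m b) ^+ 2 / (c * normoo (X^T *m (Y - X *m b))) + norm1 b.

Definition trex (R : realType) (n p : nat) (c : R) (X : 'M[R]_(n, p))
    (Y : 'cV[R]_n) : set 'cV[R]_p :=
  argmin (trex_dom X Y) (trex_obj c X Y).

(* Main.v *)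
Require Import Defs.
From HB Require Import structures.
From mathcomp Require Import all_boot all_order all_algebra.
From mathcomp Require Import classical_sets reals normedtype.
From mathcomp Require Import ring lra.
Import Order.TTheory GRing.Theory Num.Theory.
Local Open Scope ring_scope.

(** The estimator is compared with the zero vector, not with [beta_star]: at 0
    the objective is [norm2 Y ^+ 2 / (c * u0)], where [u0] is the sup-norm of
    [X^T *m Y].  Put [e] for the sup-norm of [X^T *m eps] and let [w] be the
    maximum of [uhat] and [2 * e / c].  The signal condition together with
    [uhat <= u0] says that [w <= u0].

    Multiplying the inequality of the objectives by [c * w], and using
    [uhat <= w] and [2 * e <= c * w], gives
      [norm2 r ^+ 2 + 2 * e * norm1 beta_hat <= (w / u0) * norm2 Y ^+ 2],
    [r] being the residual at the estimator ([trex_residual_le]).  The l1 term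
    on the left is what pays for the noise: expanding the residual around the
    truth, the only term that involves the estimator is twice the inner product
    of [eps] with [X *m beta_hat], and Hoelder's inequality ([dot_mulmx_le])
    bounds that by [2 * e * norm1 beta_hat].  So the prediction error is at most
      [(w / u0) * norm2 Y ^+ 2 - norm2 eps ^+ 2 - 2 * dot eps (X *m beta_star)].

    Now expand [Y] as well.  As [w / u0 <= 1], the term in [norm2 eps ^+ 2] has
    a nonpositive coefficient and can be dropped; there remain the noise-signal
    inner product with coefficient [- 2 * (1 - w / u0)], and [w / u0] times the
    squared norm of [X *m beta_star].  Hoelder's inequality bounds the former by
    [2 * (1 - w / u0) * e * norm1 beta_star] and the latter by
    [(w / u0) * (u0 + e) * norm1 beta_star], and these add up to at most
    [(2 * e + w) * norm1 beta_star]. *)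

Lemma le_normoo {R : realType} {m : nat} (v : 'cV[R]_m) (i : 'I_m) :
  `|v i 0| <= normoo v.
Proof.
rewrite /normoo mx_normrE.
exact: (le_bigmax _ (fun ij : 'I_m * 'I_1 => `|v ij.1 ij.2|) (i, 0)).
Qed.

Lemma normoo_ge0 {R : realType} {m : nat} (v : 'cV[R]_m) : 0 <= normoo v.
Proof. exact: (normr_ge0 v). Qed.

Lemma normooD {R : realType} {m : nat} (u v : 'cV[R]_m) :
  normoo (u + v) <= normoo u + normoo v.
Proof. exact: ler_mx_norm_add. Qed.

Lemma norm1_ge0 {R : realType} {m : nat} (v : 'cV[R]_m) : 0 <= norm1 v.
Proof. exact: sumr_ge0. Qed.

Definition dot {R : realType} {m : nat} (u v : 'cV[R]_m) : R := (u^T *m v) 0 0.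

Lemma dotE {R : realType} {m : nat} (u v : 'cV[R]_m) :
  dot u v = \sum_(i < m) u i 0 * v i 0.
Proof. by rewrite /dot mxE; apply: eq_bigr => i _; rewrite mxE. Qed.

Lemma dotBr {R : realType} {m : nat} (u v w : 'cV[R]_m) :
  dot u (v - w) = dot u v - dot u w.
Proof. by rewrite /dot mulmxBr !mxE. Qed.

Lemma norm2_sqr {R : realType} {m : nat} (v : 'cV[R]_m) :
  norm2 v ^+ 2 = dot v v.
Proof.
rewrite /norm2 sqr_sqrtr ?dotE; last by apply: sumr_ge0 => i _; exact: sqr_ge0.
by apply: eq_bigr => i _; rewrite expr2.
Qed.

Lemma norm2D_sqr {R : realType} {m : nat} (u v : 'cV[R]_m) :
  norm2 (u + v) ^+ 2 = norm2 u ^+ 2 + 2 * dot u v + norm2 v ^+ 2.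
Proof.
rewrite !norm2_sqr !dotE mulr_sumr -!big_split /=.
by apply: eq_bigr => i _; rewrite !mxE; ring.
Qed.

Lemma norm2B_sqr {R : realType} {m : nat} (u v : 'cV[R]_m) :
  norm2 (u - v) ^+ 2 = norm2 u ^+ 2 - 2 * dot u v + norm2 v ^+ 2.
Proof.
rewrite !norm2_sqr !dotE mulr_sumr -sumrB -big_split /=.
by apply: eq_bigr => i _; rewrite !mxE; ring.
Qed.

(** Hoelder's inequality for the dual pair l1 and l-infinity, once [X] has been
    moved to the other side of the inner product. *)
Lemma dot_mulmx_le {R : realType} {n p : nat} (X : 'M[R]_(n, p))
    (u : 'cV[R]_n) (b : 'cV[R]_p) :
  `|dot u (X *m b)| <= normoo (X^T *m u) * norm1 b.
Proof.
have -> : dot u (X *m b) = dot (X^T *m u) b.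
  by rewrite /dot trmx_mul trmxK mulmxA.
rewrite dotE /norm1 mulr_sumr; apply: le_trans (ler_norm_sum _ _ _) _.
by apply: ler_sum => i _; rewrite normrM ler_wpM2r ?le_normoo.
Qed.

(** Optimality against the zero vector, cleared of denominators with [c * w] for
    a free [w] instead of the sup-norm [u] of the estimator's own correlations.
    The squared residual then comes with the factor [w / u], which is at least 1
    and is dropped; in exchange the l1 term gets a weight as large as the noise
    requires.  Zero is a competitor because [0 < u <= normoo (X^T *m Y)]. *)
Lemma trex_residual_le {R : realType} {n p : nat} (c w : R)
    (X : 'M[R]_(n, p)) (Y : 'cV[R]_n) (bhat : 'cV[R]_p) :
  0 < c -> trex c X Y bhat ->
  normoo (X^T *m (Y - X *m bhat)) <= normoo (X^T *m Y) ->
  normoo (X^T *m (Y - X *m bhat)) <= w ->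
  norm2 (Y - X *m bhat) ^+ 2 + c * w * norm1 bhat
  <= w / normoo (X^T *m Y) * norm2 Y ^+ 2.
Proof.
move=> c_gt0 [/= dom_bhat bhat_min].
set u := normoo _ in dom_bhat *; set u0 := normoo (X^T *m Y) => le_u_u0 le_u_w.
have u_gt0 : 0 < u by rewrite lt_neqAle eq_sym dom_bhat normoo_ge0.
have u0_gt0 : 0 < u0 := lt_le_trans u_gt0 le_u_u0.
have w_gt0 : 0 < w := lt_le_trans u_gt0 le_u_w.
have /bhat_min : trex_dom X Y 0.
  by rewrite /trex_dom /= mulmx0 subr0; exact: lt0r_neq0.
rewrite /trex_obj mulmx0 subr0 -/u -/u0.
have -> : norm1 (0 : 'cV[R]_p) = 0.
  by rewrite /norm1 big1 // => i _; rewrite mxE normr0.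
rewrite addr0; set r2 := norm2 (_ - _) ^+ 2 => le_obj.
have cw_gt0 : 0 < c * w by rewrite mulr_gt0.
have -> : w / u0 * norm2 Y ^+ 2 = c * w * (norm2 Y ^+ 2 / (c * u0)).
  by field; rewrite !lt0r_neq0.
apply: le_trans (_ : c * w * (r2 / (c * u) + norm1 bhat) <= _); last first.
  by rewrite ler_pM2l.
have -> : c * w * (r2 / (c * u) + norm1 bhat) = r2 * (w / u) + c * w * norm1 bhat.
  by field; rewrite !lt0r_neq0.
by rewrite lerD2r ler_peMr ?sqr_ge0 // ler_pdivlMr // mul1r.
Qed.

Theorem theorem2 (R : realType) (n p : nat) (n_gt0 : (0 < n)%N)
    (X : 'M[R]_(n, p)) (Y eps : 'cV[R]_n) (beta_star beta_hat : 'cV[R]_p)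
    (c uhat : R)
    (hX : forall j : 'I_p, norm2 (col j X) = Num.sqrt (n%:R : R))
    (hY : Y = X *m beta_star + eps)
    (c_gt0 : 0 < c) (c_lt2 : c < 2)
    (hbeta_hat : trex c X Y beta_hat)
    (huhat : uhat = normoo (X^T *m (Y - X *m beta_hat)))
    (hsignal : (1 + 2 / c) * normoo (X^T *m eps)
               <= normoo (X^T *m (X *m beta_star)))
    (huhat_le : uhat <= normoo (X^T *m Y)) :
  norm2 (X *m beta_hat - X *m beta_star) ^+ 2 / n%:R
  <= (2 * normoo (X^T *m eps)
      + Num.max uhat (2 * normoo (X^T *m eps) / c)) * norm1 beta_star / n%:R.
Proof.
rewrite ler_pM2r ?invr_gt0 ?ltr0n //.
set w := Num.max _ _; set e := normoo (X^T *m eps) in w hsignal *.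
set u0 := normoo (X^T *m Y) in huhat_le.
have e_ge0 : 0 <= e := normoo_ge0 _.
have uhat_gt0 : 0 < uhat.
  by rewrite huhat lt_neqAle eq_sym normoo_ge0 andbT; case: hbeta_hat.
have u0_gt0 : 0 < u0 := lt_le_trans uhat_gt0 huhat_le.
have le_uhat_w : uhat <= w by rewrite le_max lexx.
have w_gt0 : 0 < w := lt_le_trans uhat_gt0 le_uhat_w.
have le_2e_cw : 2 * e <= c * w.
  by rewrite -ler_pdivrMl // mulrC le_max lexx orbT.
have le_signal_u0 : normoo (X^T *m (X *m beta_star)) <= u0 + e.
  have -> : X *m beta_star = Y - eps by rewrite hY addrK.
  rewrite mulmxBr; apply: le_trans (normooD _ _) _.
  by rewrite lerD2l /normoo mx_normN.
have le_w_u0 : w <= u0.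
  rewrite ge_max huhat_le /= -(lerD2r e); apply: le_trans le_signal_u0.
  by apply: le_trans hsignal; rewrite le_eqVlt; apply/orP; left; apply/eqP; ring.
set k := w / u0.
have k_ge0 : 0 <= k by rewrite divr_ge0 // ltW.
have k_le1 : k <= 1 by rewrite ler_pdivrMr // mul1r.
have ku0 : k * u0 = w by rewrite /k divfK // lt0r_neq0.
have := trex_residual_le c w X Y beta_hat c_gt0 hbeta_hat.
rewrite -huhat => /(_ huhat_le le_uhat_w); rewrite -/u0 -/k.
have -> : Y - X *m beta_hat = eps - (X *m beta_hat - X *m beta_star).
  by rewrite hY opprB addrCA addrA.
have -> : norm2 Y ^+ 2 = norm2 eps ^+ 2 + 2 * dot eps (X *m beta_star)
    + norm2 (X *m beta_star) ^+ 2 by rewrite hY addrC norm2D_sqr.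
rewrite norm2B_sqr dotBr.
set A := norm2 (X *m beta_hat - X *m beta_star) ^+ 2; set N := norm2 eps ^+ 2.
set Q := norm2 (X *m beta_star) ^+ 2; set s := dot eps (X *m beta_star).
set t := dot eps (X *m beta_hat); set B := norm1 beta_star; set b := norm1 beta_hat => basic.
have B_ge0 : 0 <= B := norm1_ge0 _.
have b_ge0 : 0 <= b := norm1_ge0 _.
have N_ge0 : 0 <= N := sqr_ge0 _.
have t_le : t <= e * b := le_trans (ler_norm _) (dot_mulmx_le X eps beta_hat).
have s_ge : - s <= e * B.
  by apply: le_trans (dot_mulmx_le X eps beta_star); rewrite -normrN ler_norm.
have Q_le : Q <= (u0 + e) * B.
  rewrite /Q norm2_sqr; apply: le_trans (ler_norm _) _.
  by apply: le_trans (dot_mulmx_le _ _ _) _; rewrite ler_wpM2r.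
have pay : 2 * e * b <= c * w * b by rewrite ler_wpM2r.
have kN : 0 <= (1 - k) * N by rewrite mulr_ge0 // subr_ge0.
have ks : (1 - k) * - s <= (1 - k) * (e * B) by rewrite ler_wpM2l // subr_ge0.
have kQ : k * Q <= w * B + k * (e * B).
  by rewrite -ku0 -mulrA -mulrDr -mulrDl ler_wpM2l.
have keB : 0 <= k * (e * B) := mulr_ge0 k_ge0 (mulr_ge0 e_ge0 B_ge0).
lra.
Qed.
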